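(* Given functions $k(t)$ and $M(t)$ of a parameter $t$ (in an interval) and $\epsilon=\pm1$, there exists a nondegenerate space curve $x(t)$ in $\mathbf{A}^3$ without affine inflection points for which $t$ is a general-affine length parameter, $k$ is the first general-affine curvature, $M$ is the second general-affine curvature, and $\epsilon$ is the sign of $\ell$. Such a curve is unique up to a general-affine transformation of $\mathbf{A}^3$.
   Context: All functions and curves are smooth. General-affine transformations of $\mathbf{A}^3$ are the elements of $\mathrm{GA}(3)=\mathrm{GL}(3,\mathbf{R})\ltimes\mathbf{R}^3$. A parametrized curve $x=x(t)$ in $\mathbf{A}^3$ is nondegenerate if $x',x'',x'''$ are linearly independent at every point. For a nondegenerate curve there exist a frame $e_1,e_2,e_3$ along $x$ (smooth, pointwise linearly independent vector fields along $x$, with $e_1$ a positive multiple of $dx/dt$), a $1$-form $\omega$ and functions $\ell,m$ such that $dx=\omega e_1$, $de_1=\omega e_2$, $de_2=\omega e_3$, $de_3=-m\omega e_1-\ell\omega e_2$. These are unique up to $\tilde e_i=\lambda^ie_i$ ($i=1,2,3$), $\tilde\omega=\lambda^{-1}\omega$, $\tilde\ell=\lambda^2\ell$, $\tilde m=\lambda^3m$ with a constant $\lambda>0$. A point where $\ell=0$ is an affine inflection point. Where $\ell\neq0$, put $\epsilon=\mathrm{sign}(\ell)$. The general-affine length element is $\omega_s=\sqrt{\epsilon\ell}\,\omega$; a general-affine length parameter is a parameter $s$ with $ds=\omega_s$. The first general-affine curvature $k$ is defined by $d\ell/\ell=k\,\omega_s$, and the second general-affine curvature is $M=m/(\epsilon\ell)^{3/2}$.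 *)

(* Defs.v *)
From HB Require Import structures.
From mathcomp Require Import all_boot all_order all_algebra.
From mathcomp Require Import all_classical all_reals all_analysis.

Set Implicit Arguments.
Unset Strict Implicit.
Unset Printing Implicit Defensive.

Import Order.TTheory GRing.Theory Num.Theory.
Import numFieldNormedType.Exports.

Local Open Scope ring_scope.
Local Open Scope classical_set_scope.

(* Smoothness on an arbitrary subset A of the line: f is C^oo on an open
   neighbourhood of A.  For A open this is plain smoothness on A; at an endpoint
   of a nontrivial interval A it is smooth extendability past that endpoint, and
   the derivatives there are determined by the values of f on A. *)
Definition smooth_on (R : realType) (V : normedModType R) (A : set R)
    (f : R -> V) : Prop :=
  forall t, A t -> \forall s \near t, forall n, derivable (derive1n n f) s 1.

Definition nondegenerate_on (R : realType) (I : set R) (x : R -> 'cV[R]_3) :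
    Prop :=
  smooth_on I x /\
  (forall t, I t -> free [:: derive1n 1 x t; derive1n 2 x t; derive1n 3 x t]).

(* A frame e1, e2, e3 along a parametrized curve, a 1-form omega = w(t) dt,
   represented by its coefficient w, and the functions l and m. *)
Record frame_data (R : realType) := FrameData {
  fr_e1 : R -> 'cV[R]_3;
  fr_e2 : R -> 'cV[R]_3;
  fr_e3 : R -> 'cV[R]_3;
  fr_w : R -> R;
  fr_l : R -> R;
  fr_m : R -> R }.

(* The structure equations are equalities of (vector-valued) 1-forms on I,
   written as equalities of the coefficients of dt. *)
Record is_affine_frame (R : realType) (I : set R) (x : R -> 'cV[R]_3)
    (F : frame_data R) : Prop := IsAffineFrame {
  smooth_e1 : smooth_on I (fr_e1 F);
  smooth_e2 : smooth_on I (fr_e2 F);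
  smooth_e3 : smooth_on I (fr_e3 F);
  smooth_w : smooth_on I (fr_w F);
  smooth_l : smooth_on I (fr_l F);
  smooth_m : smooth_on I (fr_m F);
  frame_free : forall t, I t -> free [:: fr_e1 F t; fr_e2 F t; fr_e3 F t];
  frame_pos : forall t, I t ->
    exists2 c : R, 0 < c & fr_e1 F t = c *: derive1 x t;
  frame_dx : forall t, I t -> derive1 x t = fr_w F t *: fr_e1 F t;
  frame_de1 : forall t, I t -> derive1 (fr_e1 F) t = fr_w F t *: fr_e2 F t;
  frame_de2 : forall t, I t -> derive1 (fr_e2 F) t = fr_w F t *: fr_e3 F t;
  frame_de3 : forall t, I t ->
    derive1 (fr_e3 F) t = - (fr_m F t * fr_w F t) *: fr_e1 F t
                          - (fr_l F t * fr_w F t) *: fr_e2 F t }.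

(* The notions below are read off an affine frame of the curve.  They do not
   depend on which one: another affine frame replaces (w, l, m) by
   (c^-1 w, c^2 l, c^3 m) for a constant c > 0. *)
Definition affine_inflection (R : realType) (F : frame_data R) (t : R) : Prop :=
  fr_l F t = 0.

(* The coefficient of dt in omega_s. *)
Definition length_density (R : realType) (F : frame_data R) (t : R) : R :=
  Num.sqrt (Num.sg (fr_l F t) * fr_l F t) * fr_w F t.

Definition is_length_param (R : realType) (I : set R) (F : frame_data R) :
    Prop :=
  forall t, I t -> length_density F t = 1.

Definition is_first_curvature (R : realType) (I : set R) (F : frame_data R)
    (k : R -> R) : Prop :=
  forall t, I t ->
    derive1 (fr_l F) t / fr_l F t = k t * length_density F t.

Definition is_second_curvature (R : realType) (I : set R) (F : frame_data R)
    (M : R -> R) : Prop :=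
  forall t, I t ->
    M t = fr_m F t / (Num.sg (fr_l F t) * fr_l F t) `^ (3 / 2).

Definition curve_with_invariants (R : realType) (I : set R) (eps : R)
    (k M : R -> R) (x : R -> 'cV[R]_3) : Prop :=
  nondegenerate_on I x /\
  exists F : frame_data R,
    [/\ is_affine_frame I x F,
        forall t, I t -> ~ affine_inflection F t,
        is_length_param I F,
        is_first_curvature I F k /\ is_second_curvature I F M
      & forall t, I t -> Num.sg (fr_l F t) = eps].

Definition general_affine (R : realType) (g : 'cV[R]_3 -> 'cV[R]_3) : Prop :=
  exists (A : 'M[R]_3) (b : 'cV[R]_3),
    A \in unitmx /\ forall p, g p = A *m p + b.

(* Main.v *)
Require Import Defs.
From HB Require Import structures.
From mathcomp Require Import all_boot all_order all_algebra.
From mathcomp Require Import ring lra.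
From mathcomp Require Import all_classical all_reals all_analysis.
Import Order.TTheory GRing.Theory Num.Theory.
Import numFieldNormedType.Exports.
Local Open Scope ring_scope.
Local Open Scope classical_set_scope.
Set Implicit Arguments.
Unset Strict Implicit.
Unset Printing Implicit Defensive.

(** Let omega = w dt.  Saying that t is a length parameter means that
    eps l w ^ 2 = 1, and then the rescaled frame f_i = w ^ i e_i carries no
    arbitrary constant: f_1 = x', and the structure equations become

      f_1' = - (k / 2) f_1 + f_2,
      f_2' = - k f_2 + f_3,
      f_3' = - M f_1 - eps f_2 - (3 k / 2) f_3,

    that is, E' = E C for the matrix E with columns f_i, where C
    ([structure_mx]) depends on eps, k and M alone.  The theorem thus reduces to
    linear differential equations.

    Uniqueness.  If E and G are the matrices of two curves x and y, both are
    invertible solutions of the same equation, hence G = A E for a constant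
    invertible A ([linear_ode_proportional]).  First columns give y' = A x', so
    y - A x is constant.  The computation of C differentiates identities that
    hold on I only, so it is made in the interior of I; the mean value theorem
    brings the conclusion to the endpoints ([cst_of_derive0]).

    Existence.  The functions k and M are smooth on an open interval J that
    contains I ([smooth_on_open_interval]), and E' = E C has an invertible
    solution on the whole of J ([fundamental_matrices]).  A primitive of its
    first column is a curve x, and with L = exp (1/2 int k) the choice
    w = 1 / L, l = eps L ^ 2, m = M L ^ 3, e_i = L ^ i f_i undoes the rescaling.

    Global solvability of linear equations ([linear_ode_solution]) comes from
    the Picard series, whose terms satisfy P_(N+1)' = A P_N and P_(N+1) (c) = 0.
    On a compact interval they are dominated by the terms of an exponential
    series, so the sum converges locally uniformly on J, whatever the behaviour
    of A near the ends of J. *)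

(** * Derivatives of matrix-valued functions *)

Lemma is_derive_mxP (R : realType) m n (F : R -> 'M[R]_(m, n)) (t : R)
    (D : 'M[R]_(m, n)) :
  is_derive t 1 F D <-> forall i j, is_derive t 1 (fun s => F s i j) (D i j).
Proof.
split=> [FD i j|FD].
  have dF : derivable F t 1 by exact: ex_derive.
  split; first by move/derivable_mxP: dF.
  by rewrite -(derive_val (is_derive := FD)) derive_mx // mxE.
have dF : derivable F t 1 by apply/derivable_mxP => i j; exact: ex_derive.
split => //; rewrite derive_mx //; apply/matrixP => i j; rewrite mxE.
exact: derive_val.
Qed.

Lemma is_derive_mulmx (R : realType) m n p (A : R -> 'M[R]_(m, n))
    (B : R -> 'M[R]_(n, p)) (t : R) A' B' :
  is_derive t 1 A A' -> is_derive t 1 B B' ->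
  is_derive t 1 (fun s => A s *m B s) (A' *m B t + A t *m B').
Proof.
move=> /is_derive_mxP dA /is_derive_mxP dB; apply/is_derive_mxP => i j.
have d l := is_deriveM (dA i l) (dB l j).
have := is_derive_sum d.
rewrite (_ : \sum_(l < n) _ = fun s => (A s *m B s) i j); last first.
  by apply/funext => s; rewrite mxE fct_sumE.
move/is_derive_eq; apply; rewrite !mxE -big_split; apply: eq_bigr => l _ /=.
by rewrite !/(_ *: _) /=; ring.
Qed.

Lemma is_derive_scale (R : realType) m n (c : R -> R) (v : R -> 'M[R]_(m, n))
    (t c' : R) v' :
  is_derive t 1 c c' -> is_derive t 1 v v' ->
  is_derive t 1 (fun s => c s *: v s) (c' *: v t + c t *: v').
Proof.
move=> dc /is_derive_mxP dv; apply/is_derive_mxP => i j.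
have := is_deriveM dc (dv i j).
rewrite (_ : c * _ = fun s => (c s *: v s) i j); last first.
  by apply/funext => s; rewrite mxE.
by move/is_derive_eq; apply; rewrite !mxE !/(_ *: _) /=; ring.
Qed.

Lemma is_derive_continuous (R : realType) (V : normedModType R) (f : R -> V)
    (t : R) f' : is_derive t 1 f f' -> {for t, continuous f}.
Proof.
by move=> df; apply/differentiable_continuous/derivable1_diffP/ex_derive.
Qed.

Lemma is_derive_unique (R : realType) (V : normedModType R) (f : R -> V)
    (t : R) a b : is_derive t 1 f a -> is_derive t 1 f b -> a = b.
Proof. by move=> [_ <-] [_ <-]. Qed.

Lemma derive1_val (R : realType) (V : normedModType R) (f : R -> V) (t : R) a :
  is_derive t 1 f a -> derive1 f t = a.
Proof. by move=> [_ <-]; rewrite derive1E. Qed.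

Lemma derivable_derive1 (R : realType) (V : normedModType R) (f : R -> V)
  (t : R) : derivable f t 1 -> is_derive t 1 f (derive1 f t).
Proof. by move=> df; split => //; rewrite derive1E. Qed.

Lemma is_derive_eq_on (R : realType) (V : normedModType R) (U : set R)
    (f g : R -> V) (t : R) a : open U -> U t -> (forall s, U s -> f s = g s) ->
  is_derive t 1 f a -> is_derive t 1 g a.
Proof.
move=> oU Ut fg; apply: near_eq_is_derive.
by near=> s; apply: fg; near: s; exact: open_nbhs_nbhs.
Unshelve. all: by end_near. Qed.

(** * Intervals and constant functions *)

Lemma interior_is_interval (R : realType) (I : set R) :
  is_interval I -> is_interval I°.
Proof.
move=> itvI; apply/is_intervalPlt => x y /interior_subset Ix.
move=> /interior_subset Iy z /andP[xz zy].
have : nbhs z `]x, y[ by apply: near_in_itvoo; rewrite in_itv/= xz.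
apply: filterS => s /=; rewrite in_itv/= => /andP[xs sy].
by apply: (itvI x y) => //; rewrite !ltW.
Qed.

Lemma is_interval_itv_sub (R : realType) (J : set R) (a b : R) :
  is_interval J -> J a -> J b -> `[a, b] `<=` J.
Proof. by move=> iJ Ja Jb s /=; rewrite in_itv/=; exact: iJ. Qed.

Lemma is_interval_oo_sub_interior (R : realType) (J : set R) (a b : R) :
  is_interval J -> J a -> J b -> `]a, b[ `<=` J°.
Proof.
move=> iJ Ja Jb; rewrite -open_subsetE; last exact: interval_open.
move=> s /= s_ab; apply: (is_interval_itv_sub iJ Ja Jb).
exact: subset_itv_oo_cc.
Qed.

(** The derivative is prescribed in the interior only, while derivability at all
    points of J supplies continuity up to the endpoints: this is what the mean
    value theorem needs. *)
Lemma cst_of_derive0 (R : realType) m n (J : set R) (F : R -> 'M[R]_(m, n))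
    (s t : R) :
  is_interval J -> (forall r, J r -> derivable F r 1) ->
  (forall r, J° r -> is_derive r 1 F 0) -> J s -> J t -> F s = F t.
Proof.
move=> iJ dF F0; wlog st : s t / s <= t.
  move=> th Js Jt; have [/th|/ltW/th] := leP s t; first exact.
  by move=> /(_ Jt Js).
move=> Js Jt; apply/matrixP => i j; apply/eqP; rewrite eq_sym -subr_eq0.
have [| |c _ ->] := @MVT_segment R (fun r => F r i j) (cst 0) s t st.
- move=> r rst; apply: is_derive_eq.
    by have /is_derive_mxP := F0 r (is_interval_oo_sub_interior iJ Js Jt rst).
  by rewrite mxE.
- apply: derivable_within_continuous => r rst.
  by have /derivable_mxP := dF r (is_interval_itv_sub iJ Js Jt rst).
- by rewrite mul0r.
Qed.

Lemma open_interval_enclose (R : realType) (J : set R) (s t : R) : open J ->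
  J s -> J t -> exists a b, [/\ J a, J b, a < s < b & a < t < b].
Proof.
move=> oJ; have nb r : J r -> exists2 e, 0 < e & J (r - e) /\ J (r + e).
  move=> Jr; have /nbhs_ballP[e /= e0 reJ] : nbhs r J by exact: open_nbhs_nbhs.
  exists (e / 2); first by rewrite divr_gt0.
  by split; apply: reJ; rewrite /ball/= ?opprB ?opprD ?addKr ?addNKr
    ?normrN ?gtr0_norm; lra.
wlog st : s t / s <= t.
  move=> th Js Jt; have [/th|/ltW/th] := leP s t; first exact.
  by move=> /(_ Jt Js) [a [b [*]]]; exists a, b.
move=> /nb[d d0 [Ja _]] /nb[e e0 [_ Jb]]; exists (s - d), (t + e).
by split => //; lra.
Qed.

(** * Primitives of continuous functions *)

(** The integral from c to t with its sign: one of the two intervals is always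
    empty or reduced to a point. *)
Definition primitive (R : realType) (c : R) (g : R -> R) (t : R) : R :=
  (\int[@lebesgue_measure R]_(s in `[c, t]) g s
   - \int[@lebesgue_measure R]_(s in `[t, c]) g s)%R.

Lemma primitive_base (R : realType) (c : R) (g : R -> R) : primitive c g c = 0.
Proof. exact: subrr. Qed.

Lemma is_derive_primitive (R : realType) (J : set R) (c t : R) (g : R -> R) :
  open J -> is_interval J -> (forall s, J s -> {for s, continuous g}) ->
  J c -> J t -> is_derive t 1 (primitive c g) (g t).
Proof.
move=> oJ iJ cg Jc Jt.
have [a [b [Ja Jb /andP[ac cb] /andP[at_ tb]]]] :=
  open_interval_enclose oJ Jc Jt.
have abJ := is_interval_itv_sub iJ Ja Jb.
have gi : (@lebesgue_measure R).-integrable `[a, b] (EFin \o g).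
  apply: continuous_compact_integrable; first exact: segment_compact.
  by apply: continuous_in_subspaceT => s /[1!inE] /abJ; exact: cg.
(* A base point a to the left of both c and t makes the ordinary integral H
   usable on both sides of c. *)
pose H s := (\int[@lebesgue_measure R]_(r in `[a, s]) g r)%R.
have [dH H't] := continuous_FTC1_closed tb gi at_ (cg _ Jt).
have step u v : a <= u -> u <= v -> v <= b ->
    H v - H u = (\int[@lebesgue_measure R]_(r in `[u, v]) g r)%R.
  move=> au uv vb; rewrite /H Rintegral_itvB ?bnd_simp//; last first.
    by apply: integrableS gi => //; apply: subset_itvl; rewrite bnd_simp.
  rewrite Rintegral_itv_obnd_cbnd//.
  apply: integrableS gi => //; apply: subset_itv; rewrite bnd_simp//.
have prim s : a < s < b -> H s - H c = primitive c g s.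
  move=> /andP[as_ sb]; rewrite /primitive; have [cs|sc|<-] := ltgtP c s.
  - rewrite (set_itv_ge (b1 := BLeft s)) ?Rintegral_set0 ?subr0 ?bnd_simp
      -?ltNge//.
    by apply: step; rewrite ltW.
  - rewrite (set_itv_ge (b1 := BLeft c)) ?Rintegral_set0 ?bnd_simp -?ltNge//.
    by rewrite sub0r -step ?opprB ?ltW.
  - by rewrite !subrr.
apply: (@is_derive_eq_on _ _ `]a, b[ (fun s => H s - H c)).
- exact: interval_open.
- by rewrite /= in_itv/= at_.
- by move=> s; rewrite /= in_itv/=; exact: prim.
- have := is_deriveB (derivable_derive1 dH) (is_derive_cst (H c) t 1).
  by move/is_derive_eq; apply; rewrite H't subr0.
Qed.

(** * The Picard series *)

(** Cauchy's mean value theorem for f and (s - c) ^ N.+1.  The exact factor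
    1 / N.+1 is what produces the factorials that make the Picard series
    converge on arbitrarily long intervals. *)
Lemma is_derive_growth (R : realType) (J : set R) (f f' : R -> R) (c t C : R)
    (N : nat) : is_interval J -> J c -> J t ->
  (forall s, J s -> is_derive s 1 f (f' s)) -> f c = 0 ->
  (forall s, J s -> `|f' s| <= C * `|s - c| ^+ N) ->
  `|f t| <= C * `|t - c| ^+ N.+1 / N.+1%:R.
Proof.
move=> iJ Jc Jt df fc f'le; have [->|tc] := eqVneq t c.
  by rewrite fc subrr normr0 expr0n mulr0 mul0r.
(* Rolle's theorem for h treats t > c and t < c alike. *)
pose h s := f s * (t - c) ^+ N.+1 - f t * (s - c) ^+ N.+1.
pose h' s := f' s * (t - c) ^+ N.+1 - f t * (N.+1%:R * (s - c) ^+ N).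
have dh s : J s -> is_derive s 1 h (h' s).
  move=> Js.
  have dl : is_derive s 1 (fun r => r - c) 1.
    have := is_deriveB (is_derive_id s 1) (is_derive_cst c s 1).
    by move/is_derive_eq; apply; rewrite subr0.
  rewrite (_ : h = f * cst ((t - c) ^+ N.+1)
      - cst (f t) * (fun r => r - c) ^+ N.+1); last first.
    by apply/funext => r; rewrite /h !fctE.
  have := is_deriveB
    (is_deriveM (df s Js) (is_derive_cst ((t - c) ^+ N.+1) s 1))
    (is_deriveM (is_derive_cst (f t) s 1) (is_deriveX N.+1 dl)).
  move/is_derive_eq; apply; rewrite /h' !/(_ *: _) /= /cst; ring.
have [s [Js sc h's]] : exists s, [/\ J s, s != c & h' s = 0].
  have hct : h c = h t by rewrite /h fc subrr expr0n mulr0 mul0r !subrr.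
  have mvt a b : a < b -> J a -> J b -> h a = h b ->
      exists2 s, a < s < b & h' s = 0.
    move=> ab Ja Jb hab.
    have abJ := is_interval_itv_sub iJ Ja Jb.
    have [| |s s_ab] := @MVT R h h' a b ab.
    - by move=> s s_ab; apply/dh/abJ; exact: subset_itv_oo_cc.
    - apply: derivable_within_continuous => s s_ab.
      by apply: (ex_derive (is_derive := dh s _)); exact: abJ.
    - move=> /esym/eqP; rewrite hab subrr mulf_eq0 (subr_eq0 b a) (gt_eqF ab).
      by rewrite orbF => /eqP; exists s => //; rewrite in_itv/= in s_ab.
  have [ct|ct|ct] := ltgtP c t; last by rewrite ct eqxx in tc.
  - have [s /andP[cs st] h's] := mvt c t ct Jc Jt hct.
    by exists s; split => //; [apply: (iJ c t); rewrite ?ltW|rewrite gt_eqF].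
  - have [s /andP[ts sc] h's] := mvt t c ct Jt Jc (esym hct).
    by exists s; split => //; [apply: (iJ t c); rewrite ?ltW|rewrite lt_eqF].
have sN0 : 0 < `|s - c| ^+ N by rewrite exprn_gt0// normr_gt0 subr_eq0.
rewrite ler_pdivlMr// -(ler_pM2r sN0).
have -> : `|f t| * N.+1%:R * `|s - c| ^+ N = `|f' s| * `|t - c| ^+ N.+1.
  rewrite -(normr_nat R N.+1) -!normrX -!normrM; congr `|_|.
  by move/eqP: h's; rewrite subr_eq0 => /eqP ->; rewrite mulrA.
rewrite [leRHS]mulrAC ler_wpM2r ?exprn_ge0//; exact: f'le.
Qed.

Lemma is_derive_lipschitz (R : realType) (J : set R) (f f' : R -> R)
    (c t C : R) : is_interval J -> J c -> J t ->
  (forall s, J s -> is_derive s 1 f (f' s)) -> f c = 0 ->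
  (forall s, J s -> `|f' s| <= C) -> `|f t| <= C * `|t - c|.
Proof.
move=> iJ Jc Jt df fc f'C.
have := @is_derive_growth _ _ _ _ _ _ C 0 iJ Jc Jt df fc.
by rewrite expr1 divr1; apply => s Js; rewrite expr0 mulr1 f'C.
Qed.

Lemma series_dominated_tail (R : realType) (u v : R^nat) :
  (forall k, `|u k| <= v k) -> cvgn (series v) ->
  cvgn (series u) /\
  forall N, `|limn (series u) - series u N| <= limn (series v) - series v N.
Proof.
move=> uv cv; have cu : cvgn (series u).
  apply: normed_cvg; apply: (series_le_cvg _ _ uv cv) => // k.
  exact: le_trans (normr_ge0 _) (uv k).
split=> // N; apply: (@ler_cvg_to _ \oo _ _
  (fun M => `|series u M - series u N|) (fun M => series v M - series v N)).
- by apply: cvg_norm; apply: cvgB => //; exact: cvg_cst.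
- by apply: cvgB => //; exact: cvg_cst.
- near=> M; have NM : (N <= M)%N by near: M; exact: nbhs_infty_ge.
  rewrite !sub_series_geq//; apply: le_trans (ler_norm_sum _ _ _) _.
  exact: ler_sum.
Unshelve. all: by end_near. Qed.

Lemma entries_bounded_on_segment (R : realType) m n (A : R -> 'M[R]_(m, n))
    (a b : R) : a <= b ->
  (forall t, `[a, b] t -> forall i j, {for t, continuous (fun s => A s i j)}) ->
  exists2 L : R, 0 <= L & forall t, `[a, b] t -> forall i j, `|A t i j| <= L.
Proof.
move=> ab cA.
have bnd (ij : 'I_m * 'I_n) :
    exists2 L : R, 0 <= L & forall t, `[a, b] t -> `|A t ij.1 ij.2| <= L.
  have [|c _ cmax] := @EVT_max _ (fun t => `|A t ij.1 ij.2|) a b ab.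
    apply: continuous_in_subspaceT => t /[1!inE] tab.
    by apply: cvg_norm; exact: cA.
  by exists `|A c ij.1 ij.2| => // t; exact: cmax.
have [L L0 AL] := fin_all_exists2 bnd.
exists (\sum_ij L ij) => [|t tab i j]; first by apply: sumr_ge0.
apply: le_trans (AL (i, j) t tab) _.
by rewrite (bigD1 (i, j))//= lerDl sumr_ge0.
Qed.

Fixpoint picard (R : realType) n p (c : R) (A : R -> 'M[R]_n)
    (Y0 : 'M[R]_(n, p)) (N : nat) : R -> 'M[R]_(n, p) :=
  if N is N'.+1 then fun t => \matrix_(i, j)
    primitive c (fun s => (A s *m picard c A Y0 N' s) i j) t
  else fun=> Y0.

Lemma continuous_mulmx_entry (R : realType) m n p (A : R -> 'M[R]_(m, n))
    (B : R -> 'M[R]_(n, p)) (t : R) i j :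
  (forall k, {for t, continuous (fun s => A s i k)}) ->
  (forall k, {for t, continuous (fun s => B s k j)}) ->
  {for t, continuous (fun s => (A s *m B s) i j)}.
Proof.
move=> cA cB; rewrite /prop_for /continuous_at mxE.
under eq_fun do rewrite mxE.
apply: cvg_big => [|k _]; first exact: add_continuous.
by apply: cvgM; [exact: cA|exact: cB].
Qed.

Definition picard_sum (R : realType) n p (c : R) (A : R -> 'M[R]_n)
    (Y0 : 'M[R]_(n, p)) (N : nat) (t : R) : 'M[R]_(n, p) :=
  \sum_(k < N) picard c A Y0 k t.

Definition picard_lim (R : realType) n p (c : R) (A : R -> 'M[R]_n)
    (Y0 : 'M[R]_(n, p)) (t : R) : 'M[R]_(n, p) :=
  \matrix_(i, j) limn (fun N => picard_sum c A Y0 N t i j).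

Section Picard.
Context (R : realType) (n p : nat) (J : set R) (c : R) (A : R -> 'M[R]_n).
Context (Y0 : 'M[R]_(n, p)).
Hypotheses (oJ : open J) (iJ : is_interval J) (Jc : J c).
Hypothesis cA : forall t, J t -> forall i j,
  {for t, continuous (fun s => A s i j)}.

Let P := picard c A Y0.
Let S := picard_sum c A Y0.
Let Y := picard_lim c A Y0.

Lemma is_derive_picardS N t : J t -> is_derive t 1 (P N.+1) (A t *m P N t).
Proof.
elim: N t => [|N IH] t Jt; apply/is_derive_mxP => i j.
- under eq_fun do rewrite mxE.
  apply: is_derive_primitive oJ iJ _ Jc Jt => s Js.
  apply: continuous_mulmx_entry => k; first exact: cA.
  exact: cvg_cst.
- under eq_fun do rewrite mxE.
  apply: is_derive_primitive oJ iJ _ Jc Jt => s Js.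
  apply: continuous_mulmx_entry => k; first exact: cA.
  by have /is_derive_mxP/(_ k j)/is_derive_continuous := IH s Js.
Qed.

Lemma picardS_base N : P N.+1 c = 0.
Proof. by apply/matrixP => i j; rewrite !mxE primitive_base. Qed.

(** The entry bound L for A becomes the factor n L because an entry of A P_N is
    a sum of n products. *)
Lemma picard_bound (a b L K : R) N (t : R) i j :
  `[a, b] `<=` J -> a <= c <= b ->
  (forall s, `[a, b] s -> forall i j, `|A s i j| <= L) ->
  (forall i j, `|Y0 i j| <= K) -> `[a, b] t ->
  `|P N t i j| <= K * exp_coeff (n%:R * L * `|t - c|) N.
Proof.
move=> abJ acb AL YK; elim: N t i j => [|N IH] t i j tab.
  by rewrite /exp_coeff/= expr0 fact0 divr1 mulr1 YK.
have cab : `[a, b] c by rewrite /= in_itv.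
have := @is_derive_growth _ `[a, b] (fun s => P N.+1 s i j)
  (fun s => (A s *m P N s) i j) c t (K * (n%:R * L) ^+ N.+1 / N`!%:R) N
  (@interval_is_interval _ _) cab tab.
move=> /(_ _ _ _)/le_trans; apply.
- by move=> s sab; have /is_derive_mxP := is_derive_picardS N (abJ _ sab).
- by rewrite picardS_base mxE.
- move=> s sab; rewrite mxE (le_trans (ler_norm_sum _ _ _))//.
  apply: (@le_trans _ _
    (\sum_(k < n) (L * (K * exp_coeff (n%:R * L * `|s - c|) N)))).
    by apply: ler_sum => k _; rewrite normrM ler_pM// ?AL ?IH.
  rewrite sumr_const card_ord -mulr_natl /exp_coeff/= exprMn exprS.
  by rewrite le_eqVlt; apply/predU1P; left; ring.
- rewrite le_eqVlt; apply/predU1P; left.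
  by rewrite /exp_coeff/= factS natrM invfM [in RHS]exprMn; ring.
Qed.

Lemma is_derive_picard_sum N t : J t ->
  is_derive t 1 (S N.+1) (A t *m S N t).
Proof.
move=> Jt; elim: N => [|N IH].
  rewrite [S 0 t]big_ord0 mulmx0 (_ : S 1 = cst Y0).
    exact: is_derive_cst.
  by apply/funext => s; rewrite /S /picard_sum big_ord1.
have -> : S N.+2 = S N.+1 + P N.+1.
  by apply/funext => s; rewrite /S /picard_sum big_ord_recr.
rewrite [X in A t *m X]/S /picard_sum big_ord_recr mulmxDr.
exact: is_deriveD IH (is_derive_picardS N Jt).
Qed.

Lemma picard_sum_base N : S N.+1 c = Y0.
Proof.
rewrite /S /picard_sum big_ord_recl big1 ?addr0 // => k _.
exact: picardS_base.
Qed.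

Lemma picard_sum_series t i j :
  (fun N => S N t i j) = series (fun k => P k t i j).
Proof.
by apply/funext => N; rewrite /series /= big_mkord /S /picard_sum summxE.
Qed.

Lemma picard_sum_uniform_cvg a b : `[a, b] `<=` J -> a <= c <= b ->
  exists2 eps : R^nat, eps @ \oo --> 0 & forall N t i j, `[a, b] t ->
    `|Y t i j - S N t i j| <= eps N.
Proof.
move=> abJ acb; have ab : a <= b by case/andP: acb; exact: le_trans.
have [L L0 AL] := entries_bounded_on_segment ab (fun t tab => cA (abJ t tab)).
pose K := \sum_i \sum_j `|Y0 i j|.
have YK i j : `|Y0 i j| <= K.
  rewrite /K (bigD1 i)//= (bigD1 j)//= -addrA lerDl addr_ge0 ?sumr_ge0// => *.
  exact: sumr_ge0.
have K0 : 0 <= K by rewrite sumr_ge0 // => *; exact: sumr_ge0.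
pose v : R^nat := K *: exp_coeff (n%:R * L * (b - a)).
have cv : cvgn (series v).
  exact: is_cvg_seriesZ (is_cvg_series_exp_coeff _).
exists (fun N => limn (series v) - series v N).
  by rewrite -(subrr (limn (series v))); apply: cvgB => //; exact: cvg_cst.
move=> N t i j tab; rewrite /Y mxE -[S _ _ _ _]/
  ((fun M => S M t i j) N) picard_sum_series.
apply: (series_dominated_tail _ cv).2 => k.
apply: le_trans (picard_bound k i j abJ acb AL YK tab) _.
rewrite /v /GRing.scale /= ler_wpM2l // ler_pM2r ?invr_gt0 ?ltr0n ?fact_gt0//.
have tcab : `|t - c| <= b - a.
  move: tab acb; rewrite /= in_itv/= => tab acb; rewrite ler_norml; lra.
by rewrite lerXn2r ?nnegrE ?mulr_ge0 ?ler_wpM2l ?subr_ge0 ?mulr_ge0.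
Qed.

Lemma picard_lim_continuous t i j : J t ->
  {for t, continuous (fun s => Y s i j)}.
Proof.
move=> Jt; have [a [b [Ja Jb acb atb]]] := open_interval_enclose oJ Jc Jt.
have abJ := is_interval_itv_sub iJ Ja Jb.
have [|eps eps0 Ye] := picard_sum_uniform_cvg abJ; first lra.
apply/cvgrPdist_le => e e0.
have [N _ epsN] : \forall N \near \oo, eps N <= e / 3.
  near do apply: le_trans (ler_norm _) _.
  by apply: cvgr_norm_le eps0 _ _; rewrite normr0 divr_gt0.
have cS : {for t, continuous (fun s => S N.+1 s i j)}.
  have /is_derive_mxP/(_ i j) := is_derive_picard_sum N Jt.
  exact: is_derive_continuous.
have tab : `[a, b] t by rewrite /= in_itv/=; lra.
near=> s.
have sab : `[a, b] s.
  by near: s; apply: filterS (near_in_itvoo atb) => s; exact: subset_itv_oo_cc.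
have St : `|S N.+1 t i j - S N.+1 s i j| <= e / 3.
  by near: s; move/cvgrPdist_le : cS; apply; rewrite divr_gt0.
have := le_trans (Ye N.+1 t i j tab) (epsN _ (leqnSn N)).
have := le_trans (Ye N.+1 s i j sab) (epsN _ (leqnSn N)).
move: St; rewrite !ler_norml; lra.
Unshelve. all: by end_near. Qed.

(** The partial sums satisfy this integral equation with a shift in the index.
    Its error is estimated by comparing derivatives instead of exchanging limit
    and integral. *)
Lemma picard_lim_integral t i j : J t ->
  Y t i j = Y0 i j + primitive c (fun s => (A s *m Y s) i j) t.
Proof.
move=> Jt; have [a [b [Ja Jb acb atb]]] := open_interval_enclose oJ Jc Jt.
have abJ := is_interval_itv_sub iJ Ja Jb.
have [|eps eps0 Ye] := picard_sum_uniform_cvg abJ; first lra.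
have [|L L0 AL] := @entries_bounded_on_segment _ _ _ A a b _
  (fun t tab => cA (abJ t tab)); first lra.
set Z := primitive _ _.
have dZ s : J s -> is_derive s 1 Z ((A s *m Y s) i j).
  move=> Js; apply: is_derive_primitive oJ iJ _ Jc Js => r Jr.
  apply: continuous_mulmx_entry => k; first exact: cA.
  exact: picard_lim_continuous.
have tab : `[a, b] t by rewrite /= in_itv/=; lra.
have cab : `[a, b] c by rewrite /= in_itv/=; lra.
have gap N : `|Y t i j - (Y0 i j + Z t)|
    <= eps N.+1 + n%:R * L * eps N * `|t - c|.
  have dS s : `[a, b] s ->
      is_derive s 1 (fun r => S N.+1 r i j - Y0 i j - Z r)
        ((A s *m S N s) i j - 0 - (A s *m Y s) i j).
    move=> /abJ Js.
    have /is_derive_mxP/(_ i j) dS := is_derive_picard_sum N Js.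
    exact: is_deriveB (is_deriveB dS (is_derive_cst (Y0 i j) s 1)) (dZ s Js).
  have SZ : `|S N.+1 t i j - Y0 i j - Z t| <= n%:R * L * eps N * `|t - c|.
    have /= := @is_derive_lipschitz _ `[a, b] _ _ _ _ (n%:R * L * eps N)
      (@interval_is_interval _ _) cab tab dS.
    apply.
  - by rewrite picard_sum_base subrr sub0r /Z primitive_base oppr0.
  - move=> s sab; rewrite subr0 !mxE -sumrB.
    apply: le_trans (ler_norm_sum _ _ _) _.
    apply: (@le_trans _ _ (\sum_(k < n) (L * eps N))).
      apply: ler_sum => k _; rewrite -mulrBr normrM ler_pM ?AL//.
      by rewrite distrC Ye.
    by rewrite sumr_const card_ord -[leLHS]mulr_natl mulrA.
  have := Ye N.+1 t i j tab; move: SZ.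
  move: (_ * `|t - c|) => x; rewrite !ler_norml; lra.
have gap0 : eps N.+1 + n%:R * L * eps N * `|t - c| @[N --> \oo]
    --> 0 + n%:R * L * 0 * `|t - c|.
  apply: cvgD; first by move: eps0; rewrite -cvg_shiftS.
  by apply: cvgM; [apply: cvgM => //; exact: cvg_cst|exact: cvg_cst].
apply/eqP; rewrite -subr_eq0 -normr_le0.
by apply: le_trans (cvgr_to_ge gap0 (nearW _ gap)) _; rewrite mulr0 mul0r addr0.
Qed.

Lemma is_derive_picard_lim t : J t ->
  is_derive t 1 Y (A t *m Y t).
Proof.
move=> Jt; apply/is_derive_mxP => i j.
apply: (@is_derive_eq_on _ _ J (fun s => Y0 i j
  + primitive c (fun r => (A r *m Y r) i j) s)) => //.
  by move=> s Js; rewrite picard_lim_integral.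
rewrite -[X in is_derive _ _ _ X]add0r; apply: is_deriveD.
apply: is_derive_primitive oJ iJ _ Jc Jt => s Js.
apply: continuous_mulmx_entry => k; first exact: cA.
exact: picard_lim_continuous.
Qed.

Lemma picard_lim_base : Y c = Y0.
Proof.
apply/matrixP => i j.
by rewrite picard_lim_integral // primitive_base addr0.
Qed.

End Picard.

(** A may be unbounded near the ends of J: the Picard series is studied at
    each t in a compact interval around c and t. *)
Theorem linear_ode_solution (R : realType) (n p : nat) (J : set R) (c : R)
    (A : R -> 'M[R]_n) (Y0 : 'M[R]_(n, p)) :
  open J -> is_interval J -> J c ->
  (forall t, J t -> forall i j, {for t, continuous (fun s => A s i j)}) ->
  exists2 Y : R -> 'M[R]_(n, p),
    Y c = Y0 & forall t, J t -> is_derive t 1 Y (A t *m Y t).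
Proof.
move=> oJ iJ Jc cA; exists (picard_lim c A Y0); first exact: picard_lim_base cA.
by move=> t; exact: is_derive_picard_lim cA t.
Qed.

(** * Fundamental matrices *)

(** Psi solves the adjoint equation, so that the derivative of Phi Psi is
    Phi C Psi - Phi C Psi = 0; this shows that Phi remains invertible without
    computing its determinant. *)
Theorem fundamental_matrices (R : realType) (n : nat) (J : set R)
    (C : R -> 'M[R]_n) : open J -> is_interval J -> J !=set0 ->
  (forall t, J t -> forall i j, {for t, continuous (fun s => C s i j)}) ->
  exists Phi Psi : R -> 'M[R]_n, forall t, J t ->
    [/\ is_derive t 1 Phi (Phi t *m C t),
        is_derive t 1 Psi (- (C t *m Psi t)) & Phi t *m Psi t = 1%:M].
Proof.
move=> oJ iJ [c Jc] cC.
have [|Y Yc dY] := @linear_ode_solution _ n n J c (fun t => (C t)^T) 1%:M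
  oJ iJ Jc.
  move=> t Jt i j; rewrite /prop_for /continuous_at mxE.
  by under eq_fun do rewrite mxE; exact: cC.
have [|Psi Psic dPsi] := @linear_ode_solution _ n n J c (fun t => - C t) 1%:M
  oJ iJ Jc.
  move=> t Jt i j; rewrite /prop_for /continuous_at mxE.
  by under eq_fun do rewrite mxE; apply: cvgN; exact: cC.
have dPhi t : J t -> is_derive t 1 (fun s => (Y s)^T) ((Y t)^T *m C t).
  move=> Jt; apply/is_derive_mxP => i j; rewrite -[C t]trmxK -trmx_mul mxE.
  by under eq_fun do rewrite mxE; have /is_derive_mxP := dY t Jt.
exists (fun t => (Y t)^T), Psi => t Jt; split; first exact: dPhi.
  by rewrite -mulNmx; exact: dPsi.
have dPP s : J s -> is_derive s 1 (fun r => (Y r)^T *m Psi r) 0.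
  move=> Js; apply: is_derive_eq (is_derive_mulmx (dPhi s Js) (dPsi s Js)) _.
  by rewrite mulNmx mulmxN mulmxA subrr.
rewrite (cst_of_derive0 iJ (fun s Js => ex_derive (is_derive := dPP s Js))
  _ Jt Jc).
  by rewrite Yc Psic trmx1 mulmx1.
by move=> s /interior_subset; exact: dPP.
Qed.

(** If Psi inverts a fundamental matrix, E Psi is constant along every solution
    E, which avoids differentiating an inverse matrix. *)
Lemma linear_ode_proportional (R : realType) (n : nat) (J : set R)
    (C E G : R -> 'M[R]_n) : open J -> is_interval J ->
  (forall t, J t -> forall i j, {for t, continuous (fun s => C s i j)}) ->
  (forall t, J t -> is_derive t 1 E (E t *m C t)) ->
  (forall t, J t -> is_derive t 1 G (G t *m C t)) ->
  (forall t, J t -> E t \in unitmx) ->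
  exists A : 'M[R]_n, forall t, J t -> G t = A *m E t.
Proof.
move=> oJ iJ cC dE dG uE.
have [J0|/set0P[c Jc]] := eqVneq J set0; first by exists 0; rewrite J0.
have [Phi [Psi fund]] := fundamental_matrices oJ iJ (ex_intro _ c Jc) cC.
have const (F : R -> 'M[R]_n) :
    (forall t, J t -> is_derive t 1 F (F t *m C t)) ->
    forall t, J t -> F t = F c *m Psi c *m Phi t.
  move=> dF t Jt.
  have dFP s : J s -> is_derive s 1 (fun r => F r *m Psi r) 0.
    move=> Js; have [_ dPsi _] := fund s Js.
    apply: is_derive_eq (is_derive_mulmx (dF s Js) dPsi) _.
    by rewrite mulmxN mulmxA subrr.
  rewrite -(cst_of_derive0 iJ (fun s Js => ex_derive (is_derive := dFP s Js))
    _ Jt Jc); last by move=> s /interior_subset; exact: dFP.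
  have [_ _ PhiPsi] := fund t Jt.
  by rewrite -mulmxA (mulmx1C PhiPsi) mulmx1.
have uB : E c *m Psi c \in unitmx.
  by have := uE c Jc; rewrite {1}(const E dE c Jc) unitmx_mul => /andP[].
exists (G c *m Psi c *m invmx (E c *m Psi c)) => t Jt.
by rewrite (const G dG t Jt) (const E dE t Jt) mulmxA mulmxKV.
Qed.

(** * Smoothness *)

Definition times_derivable_on (R : realType) (V : normedModType R) (U : set R)
    (N : nat) (f : R -> V) : Prop :=
  forall m, (m < N)%N -> forall t, U t -> derivable (derive1n m f) t 1.

(** The finite orders on the right are what inductions on the order of
    differentiation can use. *)
Lemma smooth_on_openP (R : realType) (V : normedModType R) (U : set R)
    (f : R -> V) : open U ->
  smooth_on U f <-> forall N, times_derivable_on U N f.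
Proof.
move=> oU; split=> [sf N m _ t /sf/nbhs_singleton|df t Ut]; first exact.
near=> s => n; apply: (df n.+1) => //; near: s; exact: open_nbhs_nbhs.
Unshelve. all: by end_near. Qed.

Lemma times_derivableS (R : realType) (V : normedModType R) (U : set R) N
    (f : R -> V) : times_derivable_on U N.+1 f <->
  (forall t, U t -> derivable f t 1) /\ times_derivable_on U N (derive1 f).
Proof.
split=> [df|[df df'] [//|m] mN t Ut].
  split=> [t Ut|m mN t Ut]; first exact: (df 0).
  by rewrite -derive1Sn; exact: df.
by rewrite derive1Sn; exact: df'.
Qed.

Lemma times_derivableW (R : realType) (V : normedModType R) (U : set R) N
    (f : R -> V) : times_derivable_on U N.+1 f -> times_derivable_on U N f.
Proof. by move=> df m /leqW; exact: df. Qed.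

Lemma eq_times_derivable (R : realType) (V : normedModType R) (U : set R) N
    (f g : R -> V) : open U -> (forall t, U t -> f t = g t) ->
  times_derivable_on U N f -> times_derivable_on U N g.
Proof.
move=> oU; elim: N f g => [//|N IH] f g fg /times_derivableS[df df'].
have dg t : U t -> is_derive t 1 g (derive1 f t).
  by move=> Ut; apply: is_derive_eq_on oU Ut fg (derivable_derive1 (df t Ut)).
apply/times_derivableS; split=> [t Ut|].
  exact: (ex_derive (is_derive := dg t Ut)).
by apply: IH df' => t /dg/derive1_val.
Qed.

Lemma times_derivable_of_is_derive (R : realType) (V : normedModType R)
    (U : set R) N (f f' : R -> V) : open U ->
  (forall t, U t -> is_derive t 1 f (f' t)) -> times_derivable_on U N f' ->
  times_derivable_on U N.+1 f.
Proof.
move=> oU df sf'; apply/times_derivableS; split=> [t Ut|].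
  exact: (ex_derive (is_derive := df t Ut)).
by apply: eq_times_derivable oU _ sf' => t /df/derive1_val.
Qed.

Lemma times_derivable_cst (R : realType) (V : normedModType R) (U : set R) N
    (a : V) : open U -> times_derivable_on U N (fun=> a).
Proof.
move=> oU; elim: N a => [//|N IH] a.
apply: times_derivable_of_is_derive oU _ (IH 0) => t _; exact: is_derive_cst.
Qed.

Lemma times_derivableD (R : realType) (V : normedModType R) (U : set R) N
    (f g : R -> V) : open U -> times_derivable_on U N f ->
  times_derivable_on U N g -> times_derivable_on U N (fun t => f t + g t).
Proof.
move=> oU; elim: N f g => [//|N IH] f g /times_derivableS[df sf].
move=> /times_derivableS[dg sg].
apply: times_derivable_of_is_derive oU _ (IH _ _ sf sg) => t Ut.
exact: is_deriveD (derivable_derive1 (df t Ut)) (derivable_derive1 (dg t Ut)).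
Qed.

Lemma times_derivableM (R : realType) (U : set R) N (f g : R -> R) : open U ->
  times_derivable_on U N f -> times_derivable_on U N g ->
  times_derivable_on U N (fun t => f t * g t).
Proof.
move=> oU; elim: N f g => [|N IH] f g sf sg; first by move=> ?.
have [df sf'] := (times_derivableS _ _ _).1 sf.
have [dg sg'] := (times_derivableS _ _ _).1 sg.
have dfg t : U t ->
    is_derive t 1 (fun s => f s * g s) (f t * derive1 g t + g t * derive1 f t).
  move=> Ut.
  exact: is_deriveM (derivable_derive1 (df t Ut)) (derivable_derive1 (dg t Ut)).
apply: (times_derivable_of_is_derive oU dfg).
exact: (times_derivableD oU (IH _ _ (times_derivableW sf) sg')
  (IH _ _ (times_derivableW sg) sf')).
Qed.

Lemma times_derivableMl (R : realType) (U : set R) N (a : R) (f : R -> R) :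
  open U -> times_derivable_on U N f ->
  times_derivable_on U N (fun t => a * f t).
Proof.
move=> oU sf.
exact: (times_derivableM oU (@times_derivable_cst R R U N a oU) sf).
Qed.

Lemma times_derivableZ (R : realType) (U : set R) N m n (a : R -> R)
    (F : R -> 'M[R]_(m, n)) : open U -> times_derivable_on U N a ->
  times_derivable_on U N F -> times_derivable_on U N (fun t => a t *: F t).
Proof.
move=> oU; elim: N a F => [|N IH] a F sa sF; first by move=> ?.
have [da sa'] := (times_derivableS _ _ _).1 sa.
have [dF sF'] := (times_derivableS _ _ _).1 sF.
have daF t : U t -> is_derive t 1 (fun s => a s *: F s)
    (derive1 a t *: F t + a t *: derive1 F t).
  move=> Ut.
  exact: is_derive_scale (derivable_derive1 (da t Ut))
    (derivable_derive1 (dF t Ut)).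
apply: (times_derivable_of_is_derive oU daF).
exact: (times_derivableD oU (IH _ _ sa' (times_derivableW sF))
  (IH _ _ (times_derivableW sa) sF')).
Qed.

Lemma times_derivable_sum (R : realType) (V : normedModType R) (U : set R) N n
    (f : 'I_n -> R -> V) : open U -> (forall i, times_derivable_on U N (f i)) ->
  times_derivable_on U N (fun t => \sum_i f i t).
Proof.
move=> oU sf; rewrite [X in times_derivable_on _ _ X](_ : _ =
  fun t => \sum_(i <- index_enum 'I_n) f i t)//.
elim: (index_enum _) => [|i r IH].
  by under eq_fun do rewrite big_nil; exact: times_derivable_cst.
by under eq_fun do rewrite big_cons; exact: times_derivableD.
Qed.

Lemma times_derivable_mx (R : realType) (U : set R) N m n
    (F : R -> 'M[R]_(m, n)) : open U ->
  (forall i j, times_derivable_on U N (fun t => F t i j)) ->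
  times_derivable_on U N F.
Proof.
move=> oU; elim: N F => [//|N IH] F sF.
have dF t : U t -> derivable F t 1.
  by move=> Ut; apply/derivable_mxP => i j; exact: (sF i j 0).
apply/times_derivableS; split => //; apply: IH => i j.
have /times_derivableS[_] := sF i j.
apply: eq_times_derivable => // t Ut.
by rewrite !derive1E derive_mx ?mxE//; exact: dF.
Qed.

(** Bootstrapping: if the y_j are N times derivable, so is the right-hand side
    of the system, and the y_i gain one derivative. *)
Lemma times_derivable_linear_system (R : realType) (U : set R) n
    (y : 'I_n -> R -> R) (a : 'I_n -> 'I_n -> R -> R) : open U ->
  (forall i j N, times_derivable_on U N (a i j)) ->
  (forall i t, U t -> is_derive t 1 (y i) (\sum_j a i j t * y j t)) ->
  forall N i, times_derivable_on U N (y i).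
Proof.
move=> oU sa dy; elim=> [//|N IH] i.
apply: (times_derivable_of_is_derive oU (dy i)).
exact: (times_derivable_sum oU
  (fun j => times_derivableM oU (sa i j N) (IH j))).
Qed.

(** J is the connected component, around a point of I, of the interior of the
    set where P holds. *)
Lemma open_interval_of_near (R : realType) (I : set R) (P : R -> Prop) :
  is_interval I -> I !=set0 -> (forall t, I t -> \forall s \near t, P s) ->
  exists J : set R, [/\ open J, is_interval J, I `<=` J & forall t, J t -> P t].
Proof.
move=> iI [c Ic] nP; pose U := [set t | P t]°.
have IU t : I t -> U t by move=> /nP.
exists [set t | forall s, (c <= s <= t) || (t <= s <= c) -> U s]; split.
- rewrite openE => t /= Jt.
  have Ut : U t.
    by apply: Jt; case: (leP c t) => ct; rewrite ?lexx ?(ltW ct) ?orbT.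
  have /nbhs_ballP[e /= e0 eU] : nbhs t U.
    by apply: open_nbhs_nbhs; split => //; exact: open_interior.
  apply/nbhs_ballP; exists e => // r; rewrite /ball/= => tr s srange.
  have [st|st] := boolP ((c <= s <= t) || (t <= s <= c)); first exact: Jt.
  apply: eU; rewrite /ball/=; apply: le_lt_trans tr.
  have := ler_norm (t - r); have := ler_norm (r - t); rewrite (distrC r t).
  rewrite negb_or !negb_and -!ltNge in st.
  rewrite ler_norml; case/andP: st => /orP[?|?] /orP[?|?];
    case/orP: srange => /andP[? ?] ? ?; lra.
- move=> x y /= Jx Jy z xzy s szc.
  have [sc|sc] := leP c s; [apply: Jy|apply: Jx]; lra.
- move=> t It s /orP[] stc; apply: IU; [exact: (iI c t)|exact: (iI t c)].
- move=> t /(_ t); rewrite /= lexx !andbT => /(_ _)/interior_subset; apply.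
  by case: (leP c t) => // /ltW.
Qed.

Lemma smooth_on_open_interval (R : realType) (I : set R) (f g : R -> R) :
  is_interval I -> I !=set0 -> smooth_on I f -> smooth_on I g ->
  exists J : set R,
    [/\ open J, is_interval J, I `<=` J & smooth_on J f /\ smooth_on J g].
Proof.
move=> iI I0 sf sg; have [|J [oJ iJ IJ JP]] := @open_interval_of_near _ _
  (fun s => (forall n, derivable (derive1n n f) s 1) /\
            (forall n, derivable (derive1n n g) s 1)) iI I0.
  by move=> t It; apply: filterI; [exact: sf|exact: sg].
exists J; split => //.
by split; apply/smooth_on_openP => // N m _ t /JP[df dg].
Qed.

(** * Frames as matrices *)

Definition cols3 (R : realType) (a b c : 'cV[R]_3) : 'M[R]_3 :=
  \matrix_(i, j) [:: a; b; c]`_j i 0.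

Lemma col_cols3 (R : realType) (a b c : 'cV[R]_3) : col 0 (cols3 a b c) = a.
Proof. by apply/colP => i; rewrite !mxE. Qed.

Lemma mulmx_cols3 (R : realType) (a b c v : 'cV[R]_3) :
  cols3 a b c *m v = v 0 0 *: a + v 1 0 *: b + v 2 0 *: c.
Proof.
apply/colP => i; rewrite !mxE !big_ord_recl big_ord0 !mxE /=.
have -> : lift ord0 ord0 = 1 :> 'I_3 by exact/val_inj.
have -> : lift ord0 (lift ord0 ord0) = 2 :> 'I_3 by exact/val_inj.
ring.
Qed.

Lemma free3P (R : realType) (a b c : 'cV[R]_3) :
  free [:: a; b; c] <->
  forall x y z : R, x *: a + y *: b + z *: c = 0 -> [/\ x = 0, y = 0 & z = 0].
Proof.
have -> : free [:: a; b; c] = free [tuple a; b; c] by [].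
split=> [/freeP fr x y z xyz|fr].
  have := fr (fun i => [:: x; y; z]`_i).
  rewrite !big_ord_recl big_ord0 /= addr0 addrA => /(_ xyz) k0.
  by split; [exact: (k0 0)|exact: (k0 1)|exact: (k0 2)].
apply/freeP => k; rewrite !big_ord_recl big_ord0 /= addr0 addrA.
move=> /fr[k0 k1 k2].
case=> [[|[|[|//]]] i3]; [rewrite -[RHS]k0|rewrite -[RHS]k1|rewrite -[RHS]k2];
  by congr k; exact/val_inj.
Qed.

Lemma cols3_unitP (R : realType) (a b c : 'cV[R]_3) :
  cols3 a b c \in unitmx <-> free [:: a; b; c].
Proof.
split=> [uE|/free3P fr].
  apply/free3P => x y z xyz.
  pose v : 'cV[R]_3 := \col_i [:: x; y; z]`_i.
  have v0 : v = 0.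
    apply: (can_inj (mulKmx uE)); rewrite mulmx0 -[RHS]xyz mulmx_cols3.
    by rewrite !mxE.
  by split; [have := congr1 (fun u : 'cV[R]_3 => u 0 0) v0
    |have := congr1 (fun u : 'cV[R]_3 => u 1 0) v0
    |have := congr1 (fun u : 'cV[R]_3 => u 2 0) v0]; rewrite !mxE.
rewrite -unitmx_tr -row_free_unit; apply: inj_row_free => v.
move/(congr1 trmx); rewrite trmx_mul trmxK trmx0 mulmx_cols3 => /fr[v0 v1 v2].
apply/rowP => -[[|[|[|//]]] i3]; rewrite [RHS]mxE;
  [rewrite -[RHS]v0|rewrite -[RHS]v1|rewrite -[RHS]v2];
  by rewrite mxE; congr (v _ _); exact/val_inj.
Qed.

(** Both the rescaled frame and the derivatives x', x'', x''' are of this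
    triangular form with respect to a frame already known to be free. *)
Lemma free3_triangular (R : realType) (a b c : 'cV[R]_3) (p q r u v s : R) :
  p != 0 -> q != 0 -> r != 0 -> free [:: a; b; c] ->
  free [:: p *: a; u *: a + q *: b; v *: a + s *: b + r *: c].
Proof.
move=> p0 q0 r0 /free3P fr; apply/free3P => x y z xyz.
have [] := fr (x * p + y * u + z * v) (y * q + z * s) (z * r).
  by rewrite -[RHS]xyz; apply/colP => i; rewrite !mxE; ring.
move=> e1 e2 /eqP; rewrite mulf_eq0 (negbTE r0) orbF => /eqP z0; subst z.
move: e1 e2; rewrite !mul0r !addr0 => + /eqP.
rewrite mulf_eq0 (negbTE q0) orbF => + /eqP y0; subst y.
rewrite mul0r addr0 => /eqP; rewrite mulf_eq0 (negbTE p0) orbF => /eqP x0.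
by split.
Qed.

(** The matrix C of the equations satisfied by the normalized frame; its columns
    hold the coordinates of f_1', f_2' and f_3' in the frame. *)
Definition structure_mx (R : realType) (eps k M : R) : 'M[R]_3 :=
  \matrix_(i, j) (nth [::] [:: [:: - (k / 2); 0; - M];
                               [:: 1; - k; - eps];
                               [:: 0; 1; - (3 * k / 2)]] i)`_j.

Lemma cols3_structure (R : realType) (a b c : 'cV[R]_3) (eps k M : R) :
  cols3 a b c *m structure_mx eps k M =
  cols3 (- (k / 2) *: a + b) (- k *: b + c)
        (- M *: a - eps *: b - (3 * k / 2) *: c).
Proof.
apply/matrixP => i j; rewrite mxE !big_ord_recl big_ord0 !mxE /=.
by case: j => [[|[|[|//]]] j3]; rewrite /= !mxE; ring.
Qed.

Lemma is_derive_cols3 (R : realType) (a b c : R -> 'cV[R]_3) (t : R) a' b' c' :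
  is_derive t 1 a a' -> is_derive t 1 b b' -> is_derive t 1 c c' ->
  is_derive t 1 (fun s => cols3 (a s) (b s) (c s)) (cols3 a' b' c').
Proof.
move=> /is_derive_mxP da /is_derive_mxP db /is_derive_mxP dc.
apply/is_derive_mxP => i j; rewrite mxE.
under eq_fun do rewrite mxE.
by case: j => [[|[|[|//]]] j3] /=.
Qed.

Lemma structure_mx_smooth (R : realType) (U : set R) (eps : R)
    (k M : R -> R) : open U -> smooth_on U k -> smooth_on U M ->
  forall i j N,
    times_derivable_on U N (fun t => structure_mx eps (k t) (M t) i j).
Proof.
move=> oU /(smooth_on_openP _ oU) sk /(smooth_on_openP _ oU) sM i j N.
(* Every entry is an affine combination of k and M. *)
suff [a [b [d ->]]] : exists a b d : R,
    (fun t => structure_mx eps (k t) (M t) i j)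
    = fun t => a * k t + b * M t + d.
  apply: (times_derivableD oU _ (@times_derivable_cst R R U N d oU)).
  apply: (times_derivableD oU); exact: times_derivableMl.
exists (nth [::]
  [:: [:: - 2^-1; 0; 0]; [:: 0; -1; 0]; [:: 0; 0; - (3 / 2)]] i)`_j.
exists (nth [::] [:: [:: 0; 0; -1]; [:: 0; 0; 0]; [:: 0; 0; 0]] i)`_j.
exists (nth [::] [:: [:: 0; 0; 0]; [:: 1; 0; - eps]; [:: 0; 1; 0]] i)`_j.
apply/funext => t; rewrite mxE.
by case: i => [[|[|[|//]]] i3]; case: j => [[|[|[|//]]] j3] /=; ring.
Qed.

Lemma structure_mx_continuous (R : realType) (U : set R) (eps : R)
    (k M : R -> R) : open U -> smooth_on U k -> smooth_on U M ->
  forall t, U t ->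
  forall i j, {for t, continuous (fun s => structure_mx eps (k s) (M s) i j)}.
Proof.
move=> oU sk sM t Ut i j.
have := @structure_mx_smooth _ _ eps _ _ oU sk sM i j 1%N 0%N isT t Ut.
by move=> /derivable1_diffP/differentiable_continuous.
Qed.

Lemma powR_three_halves (R : realType) (q : R) : 0 <= q ->
  q `^ (3 / 2) = Num.sqrt q ^+ 3.
Proof.
move=> q0; rewrite mulrC powRrM powR12_sqrt//.
by rewrite powR_mulrn// sqrtr_ge0.
Qed.

Lemma sg_signed (R : realType) (eps q : R) : eps = 1 \/ eps = -1 -> 0 < q ->
  Num.sg (eps * q) = eps.
Proof.
move=> eps1 q0; rewrite sgrM (gtr0_sg q0) mulr1.
by case: eps1 => ->; rewrite ?sgr1 ?sgrN1.
Qed.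

(** * Uniqueness *)

(** E has the columns w ^ i e_i.  Of the length condition one keeps
    eps l w ^ 2 = 1, which gives w' = - (k / 2) w upon differentiation, since
    l' = k l; and M = m w ^ 3, since |l| = w ^ (-2). *)
Lemma normalized_frame (R : realType) (I : set R) (eps : R) (k M : R -> R)
    (x : R -> 'cV[R]_3) :
  eps = 1 \/ eps = -1 -> curve_with_invariants I eps k M x ->
  exists E : R -> 'M[R]_3, forall t, I° t ->
    [/\ is_derive t 1 E (E t *m structure_mx eps (k t) (M t)),
        E t \in unitmx & is_derive t 1 x (col 0 (E t))].
Proof.
move=> eps1 [[sx _] [[e1 e2 e3 w l m]
  [[/= se1 se2 se3 sw sl sm fe _ dx de1 de2 de3] _ dens [k1 k2] sgl]]].
rewrite /length_density /is_length_param /= in dens.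
have smooth_derive (V : normedModType R) (f : R -> V) t : smooth_on I f ->
    I t -> is_derive t 1 f (derive1 f t).
  by move=> sf /sf/nbhs_singleton/(_ 0); exact: derivable_derive1.
exists (fun t => cols3 (w t *: e1 t) ((w t * w t) *: e2 t)
                       ((w t * (w t * w t)) *: e3 t)) => t It0.
have It := interior_subset It0.
have rel s : I s -> [/\ 0 < w s, eps * l s * (w s * w s) = 1,
    M s = m s * (w s * (w s * w s)) & derive1 l s = k s * l s].
  move=> Is.
  have := dens s Is; rewrite /length_density /= sgl//.
  set q := eps * l s => qw.
  have sq0 : 0 < Num.sqrt q.
    rewrite lt0r sqrtr_ge0 andbT; apply: contra_eq_neq qw => ->.
    by rewrite mul0r eq_sym oner_eq0.
  have q0 : 0 < q by rewrite -sqrtr_gt0.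
  have wE : w s = (Num.sqrt q)^-1.
    by apply: (mulfI (lt0r_neq0 sq0)); rewrite qw mulfV// lt0r_neq0.
  split.
  - by rewrite wE invr_gt0.
  - by rewrite wE -[q in q * _]sqr_sqrtr ?ltW//; field; exact: lt0r_neq0.
  - rewrite k2// /= sgl// -/q powR_three_halves ?ltW// wE.
    by field; exact: lt0r_neq0.
  - have := k1 s Is; rewrite /length_density /= sgl// -/q qw mulr1 => <-.
    rewrite divfK//; apply: contraTneq q0 => l0.
    by rewrite /q l0 mulr0 ltxx.
have [w0 lw Mw dl] := rel t It.
have Dw := smooth_derive _ _ t sw It.
have Dl := smooth_derive _ _ t sl It; rewrite dl in Dl.
(* The relation eps l w ^ 2 = 1 may be differentiated because it holds in a
   neighbourhood of the interior point t. *)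
have w'E : derive1 w t = - (k t / 2) * w t.
  have d1 : is_derive t 1 (fun s => eps * l s * (w s * w s)) 0.
    apply: (@is_derive_eq_on R R I° (fun=> 1)) => //.
    - exact: open_interior.
    - by move=> s /interior_subset /rel[].
  have d2 := is_deriveM (is_deriveM (is_derive_cst eps t 1) Dl)
    (is_deriveM Dw Dw).
  have e0 : 0 = eps * l t * (w t * derive1 w t + w t * derive1 w t)
      + w t * w t * (eps * (k t * l t) + l t * 0) := is_derive_unique d1 d2.
  have : eps * l t * (w t * w t) * (2 * derive1 w t + k t * w t) = w t * 0.
    by rewrite [in RHS]e0; ring.
  by rewrite lw; lra.
rewrite w'E in Dw.
have epsE : eps = l t * (w t * w t).
  have : eps * eps = 1 by case: eps1 => ->; rewrite ?mulrNN mulr1.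
  by move=> ee; rewrite -[RHS]mul1r -ee -mulrA [eps * (l t * _)]mulrA lw mulr1.
have De1 := smooth_derive _ _ t se1 It; rewrite de1 //= in De1.
have De2 := smooth_derive _ _ t se2 It; rewrite de2 //= in De2.
have De3 := smooth_derive _ _ t se3 It; rewrite de3 //= in De3.
split.
- rewrite cols3_structure.
  apply: is_derive_eq (is_derive_cols3 (is_derive_scale Dw De1)
    (is_derive_scale (is_deriveM Dw Dw) De2)
    (is_derive_scale (is_deriveM Dw (is_deriveM Dw Dw)) De3)) _.
  rewrite Mw [in RHS]epsE; congr cols3; apply/colP => i;
    by rewrite !mxE /= !/(_ *: _) /= ?fctE; field.
- apply/cols3_unitP.
  have := @free3_triangular _ _ _ _ (w t) (w t * w t) (w t * (w t * w t)) 0 0 0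
    _ _ _ (fe t It).
  by rewrite !scale0r !add0r; apply; rewrite ?mulf_neq0 ?lt0r_neq0.
- by rewrite col_cols3 -dx //; exact: smooth_derive.
Qed.

Lemma curve_unique (R : realType) (I : set R) (eps : R) (k M : R -> R)
    (x y : R -> 'cV[R]_3) : is_interval I -> I° !=set0 ->
  eps = 1 \/ eps = -1 -> smooth_on I k -> smooth_on I M ->
  curve_with_invariants I eps k M x -> curve_with_invariants I eps k M y ->
  exists2 g : 'cV[R]_3 -> 'cV[R]_3,
    general_affine g & forall t, I t -> y t = g (x t).
Proof.
move=> iI [c Ic] eps1 sk sM cx cy.
have sub_smooth f : smooth_on I f -> smooth_on I° (f : R -> R).
  by move=> sf t /interior_subset; exact: sf.
have [E fE] := normalized_frame eps1 cx.
have [G fG] := normalized_frame eps1 cy.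
have [||||||A GAE] := @linear_ode_proportional _ _ I°
  (fun t => structure_mx eps (k t) (M t)) E G.
- exact: open_interior.
- exact: interior_is_interval.
- by apply: structure_mx_continuous; [exact: open_interior|exact: sub_smooth..].
- by move=> t /fE[].
- by move=> t /fG[].
- by move=> t /fE[].
have uA : A \in unitmx.
  by have [_ + _] := fG c Ic; rewrite GAE// unitmx_mul => /andP[].
have dA (t : R) v :
    is_derive t 1 x v -> is_derive t 1 (fun s => A *m x s) (A *m v).
  move=> dx; apply: is_derive_eq (is_derive_mulmx (is_derive_cst A t 1) dx) _.
  by rewrite mul0mx add0r.
have der (z : R -> 'cV[R]_3) (t : R) :
    curve_with_invariants I eps k M z -> I t -> is_derive t 1 z (derive1 z t).
  by move=> [[sz _] _] /sz/nbhs_singleton/(_ 0); exact: derivable_derive1.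
exists (fun p => A *m p + (y c - A *m x c)).
  by exists A, (y c - A *m x c).
move=> t It; rewrite addrC; apply/eqP; rewrite -subr_eq; apply/eqP.
(* The derivative of y - A x vanishes in the interior of I, where y' and x' are
   the first columns of G = A E and of E. *)
apply: (@cst_of_derive0 _ _ _ I (fun s => y s - A *m x s)) => //; last first.
- exact: interior_subset.
- move=> s Is; have [_ _ dx] := fE s Is; have [_ _ dy] := fG s Is.
  apply: is_derive_eq (is_deriveB dy (dA _ _ dx)) _.
  by rewrite GAE// !colE mulmxA subrr.
- move=> s Is.
  have d := is_deriveB (der y s cy Is) (dA s _ (der x s cx Is)).
  exact: (ex_derive (is_derive := d)).
Qed.

(** * Existence *)

Lemma curve_with_invariantsS (R : realType) (I J : set R) (eps : R)
    (k M : R -> R) (x : R -> 'cV[R]_3) : I `<=` J ->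
  curve_with_invariants J eps k M x -> curve_with_invariants I eps k M x.
Proof.
move=> IJ [[sx fx] [F [[s1 s2 s3 sw sl sm fr pos dx d1 d2 d3]
  infl dens [k1 k2] sgl]]].
split; first by split=> t /IJ; [exact: sx|exact: fx].
exists F; split.
- by split=> t /IJ; [exact: s1|exact: s2|exact: s3|exact: sw|exact: sl|exact: sm
    |exact: fr|exact: pos|exact: dx|exact: d1|exact: d2|exact: d3].
- by move=> t /IJ; exact: infl.
- by move=> t /IJ; exact: dens.
- by split=> t /IJ; [exact: k1|exact: k2].
- by move=> t /IJ; exact: sgl.
Qed.

Lemma is_derive_exp_primitive (R : realType) (J : set R) (k : R -> R)
    (a c t : R) : open J -> is_interval J -> J c ->
  (forall s, J s -> {for s, continuous k}) -> J t ->
  is_derive t 1 (fun s => expR (a * primitive c k s))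
    (a * k t * expR (a * primitive c k t)).
Proof.
move=> oJ iJ Jc ck Jt; have dp := is_derive_primitive oJ iJ ck Jc Jt.
have d := is_deriveM (is_derive_cst a t 1) dp.
have := is_derive1_comp (is_derive_expR _) d.
by move/is_derive_eq; apply; rewrite !/(_ *: _) /= /cst; ring.
Qed.

(** This exponential solves the scalar equation y' = a k y, so it inherits the
    smoothness of k as solutions of linear systems do. *)
Lemma exp_primitive_smooth (R : realType) (J : set R) (k : R -> R) (a c : R) :
  open J -> is_interval J -> J c -> smooth_on J k ->
  smooth_on J (fun s => expR (a * primitive c k s)).
Proof.
move=> oJ iJ Jc sk; have kk := (smooth_on_openP k oJ).1 sk.
apply: (smooth_on_openP _ oJ).2 => N.
have ck t : J t -> {for t, continuous k}.
  by move=> Jt; exact: is_derive_continuous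
    (derivable_derive1 (kk 1%N 0%N isT t Jt)).
apply: (@times_derivable_linear_system _ J 1
  (fun=> fun s => expR (a * primitive c k s)) (fun _ _ t => a * k t)
  oJ _ _ N 0).
  by move=> _ _ N'; exact: (times_derivableMl oJ (kk N')).
move=> _ t Jt; rewrite big_ord1.
exact: (is_derive_exp_primitive a oJ iJ Jc ck Jt).
Qed.

Lemma normalized_frame_exists (R : realType) (J : set R) (eps : R)
    (k M : R -> R) : open J -> is_interval J -> J !=set0 ->
  smooth_on J k -> smooth_on J M ->
  exists f1 f2 f3 : R -> 'cV[R]_3,
    [/\ forall N, [/\ times_derivable_on J N f1, times_derivable_on J N f2
          & times_derivable_on J N f3],
        forall t, J t -> is_derive t 1 f1 (- (k t / 2) *: f1 t + f2 t),
        forall t, J t -> is_derive t 1 f2 (- k t *: f2 t + f3 t),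
        forall t, J t -> is_derive t 1 f3
          (- M t *: f1 t - eps *: f2 t - (3 * k t / 2) *: f3 t)
      & forall t, J t -> free [:: f1 t; f2 t; f3 t]].
Proof.
move=> oJ iJ J0 sk sM.
have cC := structure_mx_continuous (eps := eps) oJ sk sM.
have [Phi [Psi fund]] := fundamental_matrices oJ iJ J0 cC.
pose f j t := col j (Phi t).
have PhiE t : Phi t = cols3 (f 0 t) (f 1 t) (f 2 t).
  apply/matrixP => i j; rewrite mxE.
  by case: j => [[|[|[|//]]] j3]; rewrite /= mxE; congr (Phi t _ _);
    exact/val_inj.
have df t (Jt : J t) j : is_derive t 1 (f j)
    (col j (cols3 (- (k t / 2) *: f 0 t + f 1 t) (- k t *: f 1 t + f 2 t)
      (- M t *: f 0 t - eps *: f 1 t - (3 * k t / 2) *: f 2 t))).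
  have [dPhi _ _] := fund t Jt; rewrite PhiE cols3_structure in dPhi.
  apply/is_derive_mxP => i l; rewrite mxE; under eq_fun do rewrite mxE.
  by move/is_derive_mxP : dPhi.
have sPhi N i j : times_derivable_on J N (fun t => Phi t i j).
  apply: (@times_derivable_linear_system _ J 3 (fun j t => Phi t i j)
    (fun j l t => structure_mx eps (k t) (M t) l j)) => [//|l l' N'|{}j t Jt].
    exact: structure_mx_smooth.
  have [/is_derive_mxP/(_ i j) d _ _] := fund t Jt.
  by apply: is_derive_eq d _; rewrite mxE; apply: eq_bigr => l _; rewrite mulrC.
have sf N j : times_derivable_on J N (f j).
  apply: (times_derivable_mx oJ) => i l; under eq_fun do rewrite mxE.
  exact: sPhi.
exists (f 0), (f 1), (f 2); split=> [N|t Jt|t Jt|t Jt|t Jt].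
- by split.
- by apply: is_derive_eq (df t Jt 0) _; apply/colP => i; rewrite [LHS]mxE mxE.
- by apply: is_derive_eq (df t Jt 1) _; apply/colP => i; rewrite [LHS]mxE mxE.
- by apply: is_derive_eq (df t Jt 2) _; apply/colP => i; rewrite [LHS]mxE mxE.
- apply/cols3_unitP; rewrite -PhiE.
  by have [_ _ /mulmx1_unit[]] := fund t Jt.
Qed.

(** The structure equations give x' = f_1, x'' = f_2 - (k / 2) f_1 and
    x''' = f_3 + v f_2 + u f_1 for some u and v: a unipotent change of frame. *)
Lemma nondegenerate_of_normalized_frame (R : realType) (J : set R)
    (k : R -> R) (x f1 f2 f3 : R -> 'cV[R]_3) : open J -> smooth_on J k ->
  (forall N, times_derivable_on J N f1) ->
  (forall t, J t -> is_derive t 1 x (f1 t)) ->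
  (forall t, J t -> is_derive t 1 f1 (- (k t / 2) *: f1 t + f2 t)) ->
  (forall t, J t -> is_derive t 1 f2 (- k t *: f2 t + f3 t)) ->
  (forall t, J t -> free [:: f1 t; f2 t; f3 t]) -> nondegenerate_on J x.
Proof.
move=> oJ sk sf1 dx df1 df2 ff.
have kk := (smooth_on_openP k oJ).1 sk.
have dx2 t : J t -> is_derive t 1 (derive1 x) (- (k t / 2) *: f1 t + f2 t).
  move=> Jt; apply: is_derive_eq_on oJ Jt _ (df1 t Jt) => s Js.
  by rewrite (derive1_val (dx s Js)).
have dx3 t : J t -> exists u v : R,
    is_derive t 1 (derive1 (derive1 x)) (u *: f1 t + v *: f2 t + f3 t).
  move=> Jt; have dk : is_derive t 1 k (derive1 k t)
    := derivable_derive1 (kk 1%N 0%N isT t Jt).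
  have dk2 := is_deriveM (is_derive_cst (- 2^-1 : R) t 1) dk.
  have d := is_deriveD (is_derive_scale dk2 (df1 t Jt)) (df2 t Jt).
  exists (- 2^-1 * derive1 k t + k t / 2 * (k t / 2)), (- (k t / 2) - k t).
  apply: (@is_derive_eq_on _ _ J
    (fun s => (- 2^-1 * k s) *: f1 s + f2 s)) => //.
    move=> s Js; rewrite (derive1_val (dx2 s Js)); congr (_ *: _ + _); ring.
  apply: is_derive_eq d _; apply/colP => i.
  by rewrite !mxE /= !/(_ *: _) /= ?fctE; field.
split.
  apply: (smooth_on_openP x oJ).2 => -[|N]; first by move=> ?.
  exact: (times_derivable_of_is_derive oJ dx (sf1 N)).
move=> t Jt; have [u [v /derive1_val x3]] := dx3 t Jt.
rewrite /derive1n /= x3 (derive1_val (dx2 t Jt)) (derive1_val (dx t Jt)).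
have := free3_triangular (- (k t / 2)) u v (oner_neq0 R) (oner_neq0 R)
  (oner_neq0 R) (ff t Jt).
by rewrite !scale1r.
Qed.

(** The affine frame is e_i = L ^ i f_i with w = 1 / L: then the diagonal terms
    - (i k / 2) f_i of the normalized equations are cancelled by the derivatives
    of the powers of L. *)
Lemma curve_exists_open (R : realType) (J : set R) (eps : R) (k M : R -> R) :
  open J -> is_interval J -> J !=set0 -> eps = 1 \/ eps = -1 ->
  smooth_on J k -> smooth_on J M ->
  exists x : R -> 'cV[R]_3, curve_with_invariants J eps k M x.
Proof.
move=> oJ iJ [c Jc] eps1 sk sM.
have [f1 [f2 [f3 [sf df1 df2 df3 ff]]]] :=
  normalized_frame_exists eps oJ iJ (ex_intro _ c Jc) sk sM.
have kk := (smooth_on_openP k oJ).1 sk.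
have MM := (smooth_on_openP M oJ).1 sM.
have kcont t : J t -> {for t, continuous k}.
  by move=> Jt; exact: is_derive_continuous
    (derivable_derive1 (kk 1%N 0%N isT t Jt)).
(* The exponent is forced by l = eps L ^ 2 and l' = k l. *)
pose L t := expR (2^-1 * primitive c k t).
pose w t := expR (- 2^-1 * primitive c k t).
have dL t : J t -> is_derive t 1 L (2^-1 * k t * L t).
  by move=> Jt; exact: (is_derive_exp_primitive 2^-1 oJ iJ Jc kcont Jt).
have L0 t : 0 < L t by exact: expR_gt0.
have LN0 t : L t != 0 by exact: lt0r_neq0.
have wE t : w t = (L t)^-1 by rewrite /w mulNr expRN.
have sL := (smooth_on_openP L oJ).1 (exp_primitive_smooth 2^-1 oJ iJ Jc sk).
have sw := exp_primitive_smooth (- 2^-1) oJ iJ Jc sk.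
have sLL N := times_derivableM oJ (sL N) (sL N).
have sLLL N := times_derivableM oJ (sL N) (sLL N).
have smooth (V : normedModType R) (g : R -> V) :
    (forall N, times_derivable_on J N g) -> smooth_on J g.
  by move=> sg; apply/smooth_on_openP.
pose x t : 'cV[R]_3 := \matrix_(i, j) primitive c (fun s => f1 s i j) t.
have dx t : J t -> is_derive t 1 x (f1 t).
  move=> Jt; apply/is_derive_mxP => i l; under eq_fun do rewrite mxE.
  apply: is_derive_primitive oJ iJ _ Jc Jt => s /df1/is_derive_mxP/(_ i l).
  exact: is_derive_continuous.
exists x; split.
  apply: (nondegenerate_of_normalized_frame oJ sk _ dx df1 df2 ff) => N.
  by have [] := sf N.
have LL0 t : 0 < L t * L t by exact: mulr_gt0.
have sgl t : Num.sg (eps * (L t * L t)) = eps by exact: sg_signed.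
have abs_l t : Num.sg (eps * (L t * L t)) * (eps * (L t * L t)) = L t * L t.
  rewrite sgl [LHS]mulrA (_ : eps * eps = 1) ?mul1r//.
  by case: eps1 => ->; rewrite ?mulrNN mulr1.
have sqrt_l t : Num.sqrt (L t * L t) = L t.
  by rewrite -expr2 sqrtr_sqr gtr0_norm.
have density t :
    Num.sqrt (Num.sg (eps * (L t * L t)) * (eps * (L t * L t))) * w t = 1.
  by rewrite abs_l sqrt_l wE mulfV.
exists (FrameData (fun t => L t *: f1 t) (fun t => (L t * L t) *: f2 t)
  (fun t => (L t * (L t * L t)) *: f3 t) w (fun t => eps * (L t * L t))
  (fun t => M t * (L t * (L t * L t)))).
split => /=.
- split => /=.
  + apply: smooth => N; have [s1 _ _] := sf N.
    exact: (times_derivableZ oJ (sL N) s1).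
  + apply: smooth => N; have [_ s2 _] := sf N.
    exact: (times_derivableZ oJ (sLL N) s2).
  + apply: smooth => N; have [_ _ s3] := sf N.
    exact: (times_derivableZ oJ (sLLL N) s3).
  + exact: sw.
  + by apply: smooth => N; exact: (times_derivableMl oJ (sLL N)).
  + by apply: smooth => N; exact: (times_derivableM oJ (MM N) (sLLL N)).
  + move=> t Jt; have := free3_triangular 0 0 0 (LN0 t) (lt0r_neq0 (LL0 t))
      (lt0r_neq0 (mulr_gt0 (L0 t) (LL0 t))) (ff t Jt).
    by rewrite !scale0r !add0r.
  + by move=> t Jt; exists (L t) => //; rewrite (derive1_val (dx t Jt)).
  + by move=> t Jt; rewrite (derive1_val (dx t Jt)) wE scalerA mulVf// scale1r.
  + move=> t Jt; apply: derive1_val.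
    apply: is_derive_eq (is_derive_scale (dL t Jt) (df1 t Jt)) _.
    by rewrite wE; apply/colP => i; rewrite !mxE; field.
  + move=> t Jt; apply: derive1_val.
    apply: is_derive_eq
      (is_derive_scale (is_deriveM (dL t Jt) (dL t Jt)) (df2 t Jt)) _.
    by rewrite wE; apply/colP => i; rewrite !mxE /= !/(_ *: _) /= ?fctE; field.
  + move=> t Jt; apply: derive1_val.
    apply: is_derive_eq (is_derive_scale
      (is_deriveM (dL t Jt) (is_deriveM (dL t Jt) (dL t Jt))) (df3 t Jt)) _.
    by rewrite wE; apply/colP => i; rewrite !mxE /= !/(_ *: _) /= ?fctE; field.
- move=> t _; rewrite /affine_inflection /= => l0; have := sgl t.
  by rewrite l0 sgr0; case: eps1 => -> /eqP; rewrite eq_sym ?oppr_eq0 oner_eq0.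
- by move=> t _; exact: density.
- split=> t Jt.
    rewrite /length_density /= density mulr1.
    have d := is_deriveM (is_derive_cst eps t 1)
      (is_deriveM (dL t Jt) (dL t Jt)).
    rewrite (derive1_val d) !/(_ *: _) /= /cst.
    have e0 : eps != 0 by case: eps1 => ->; rewrite ?oppr_eq0 oner_eq0.
    by field; rewrite LN0.
  rewrite /= abs_l powR_three_halves ?ltW// sqrt_l.
  by field; exact: LN0.
- by move=> t _; exact: sgl.
Qed.

Theorem theorem5p4 (R : realType) (I : set R) (I_itv : is_interval I)
    (I_proper : I° !=set0) (eps : R) (eps_pm1 : eps = 1 \/ eps = -1)
    (k M : R -> R) (k_smooth : smooth_on I k)
    (M_smooth : smooth_on I M) :
  (exists x : R -> 'cV[R]_3, curve_with_invariants I eps k M x) /\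
  (forall x y : R -> 'cV[R]_3,
     curve_with_invariants I eps k M x -> curve_with_invariants I eps k M y ->
     exists2 g : 'cV[R]_3 -> 'cV[R]_3,
       general_affine g & forall t, I t -> y t = g (x t)).
Proof.
split; last by move=> x y; exact: curve_unique.
have I0 : I !=set0 by have [c /interior_subset] := I_proper; exists c.
have [J [oJ iJ IJ [kJ MJ]]] :=
  smooth_on_open_interval I_itv I0 k_smooth M_smooth.
have J0 : J !=set0 by have [c /IJ] := I0; exists c.
have [x cx] := curve_exists_open oJ iJ J0 eps_pm1 kJ MJ.
by exists x; exact: curve_with_invariantsS cx.
Qed.
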